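(* Let $S\subset\mathbb{P}^3$ be a smooth cubic surface over a field $K$. Suppose $S$ contains a pair of skew $K$-lines. Then $H_S^0(K)=0$.
   Context: A $K$-line is a line $\ell \subset \mathbb{P}^3$ defined over $K$. If $\ell \not\subset S$ is a $K$-line, then $\ell\cdot S = P+Q+R$ denotes the intersection of $\ell$ with $S$ counted with multiplicity. Let $G_S(K)=\bigoplus_{P\in S(K)}\mathbb{Z}\cdot P$ be the free abelian group on $S(K)$. Let $G'_S(K)$ be the subgroup generated by all sums $P+Q+R$ with $P,Q,R\in S(K)$ (not necessarily distinct) such that (i) there is a $K$-line $\ell$ not contained in $S$ with $\ell\cdot S=P+Q+R$, or (ii) there is a $K$-line $\ell$ contained in $S$ with $P,Q,R\in\ell$. Let $\deg:G_S(K)\to\mathbb{Z}$, $\deg(\sum a_iP_i)=\sum a_i$, let $G''_S(K)=\{D\in G'_S(K):\deg(D)=0\}$, and $H_S(K)=G_S(K)/G''_S(K)$. The degree map descends to $\deg:H_S(K)\to\mathbb{Z}$, and $H^0_S(K)=\{D\in H_S(K):\deg(D)=0\}$. *)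

(* Defs.v *)
From HB Require Import structures.
From mathcomp Require Import all_boot all_algebra.
From mathcomp Require Import mpoly freeg.
From mathcomp Require Import boolp.

Set Implicit Arguments.
Unset Strict Implicit.
Unset Printing Implicit Defensive.

Import GRing.Theory.

Local Open Scope ring_scope.
Local Open Scope quotient_scope.

(* P^3 is the space of lines through the origin of K^4: a K-point of P^3 is a
   1-dimensional subspace of K^4, and a K-line of P^3 is a 2-dimensional one. *)
Definition pt (K : fieldType) := {V : {vspace 'rV[K]_4} | \dim V == 1%N}.
Definition line (K : fieldType) := {V : {vspace 'rV[K]_4} | \dim V == 2%N}.

Definition baseChange (K L : fieldType) (iota : {rmorphism K -> L})
    (V : {vspace 'rV[K]_4}) : {vspace 'rV[L]_4} :=
  <<[seq map_mx iota v | v <- vbasis V]>>%VS.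

Section Surface.
Variables (K : fieldType) (F : {mpoly K[4]}).

(* vpick (val P) is a nonzero vector of P; F is meant to be homogeneous, so the
   choice of this representative is immaterial. *)
Definition on_surface (P : pt K) : bool :=
  F.@[fun i => vpick (val P) 0 i] == 0.

Definition Spt := {P : pt K | on_surface P}.

(* The binary form obtained by restricting F to a basis of l. *)
Definition restr (l : line K) : {mpoly K[2]} :=
  F \mPo [tuple \sum_(k < 2) (vbasis (val l))`_k 0 i *: 'X_k | i < 4].

(* Containment as schemes: over a small finite field, F may vanish at every
   K-point of a line without vanishing identically on it. *)
Definition line_in (l : line K) : Prop := restr l = 0.

(* Order of vanishing of F at t = 0 along p + t q, where p spans X and q
   completes p to a basis of the 2-dimensional space V. Meaningful for X <= V
   and F not identically zero on V. *)
Definition inter_mult (V X : {vspace 'rV[K]_4}) : nat :=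
  let p := vpick X in
  let q := vpick (V :\: X)%VS in
  mup 0 (mmap polyC (fun i => (p 0 i)%:P + q 0 i *: 'X) F).

Definition on_line (l : line K) (P : Spt) : Prop :=
  (val (val P) <= val l)%VS.

End Surface.

(* Smoothness over K is geometric: the form and its partial derivatives have no
   common projective zero over any extension field of K. *)
Definition smooth (K : fieldType) (F : {mpoly K[4]}) : Prop :=
  forall (L : fieldType) (iota : {rmorphism K -> L}) (x : 'I_4 -> L),
    (map_mpoly iota F).@[x] = 0 ->
    (forall i, (map_mpoly iota F)^`M(i).@[x] = 0) ->
    forall i, x i = 0.

(* l.S = P + Q + R as geometric cycles: at each point of l over each extension
   field of K, the intersection multiplicity is the coefficient of that point
   in P + Q + R. *)
Definition inter_cycle (K : fieldType) (F : {mpoly K[4]}) (l : line K)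
    (P Q R : Spt F) : Prop :=
  forall (L : fieldType) (iota : {rmorphism K -> L}) (X : pt L),
    (val X <= baseChange iota (val l))%VS ->
    inter_mult (map_mpoly iota F) (baseChange iota (val l)) (val X) =
      (count_mem (val X)
         [seq baseChange iota (val (val Y)) | Y <- [:: P; Q; R]])%N.

Inductive gen_subgroup (V : zmodType) (A : V -> Prop) : V -> Prop :=
| gen_subgroup_in x of A x : gen_subgroup A x
| gen_subgroup0 : gen_subgroup A 0
| gen_subgroupB x y of gen_subgroup A x & gen_subgroup A y :
    gen_subgroup A (x - y).

Section Groups.
Variables (K : fieldType) (F : {mpoly K[4]}).

Definition G : zmodType := {freeg (Spt F) / int}.

Definition G'_gen (D : G) : Prop :=
  exists2 PQR : Spt F * Spt F * Spt F,
    D = << PQR.1.1 >> + << PQR.1.2 >> + << PQR.2 >> &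
    (exists2 l : line K, ~ line_in F l & inter_cycle l PQR.1.1 PQR.1.2 PQR.2)
    \/ (exists2 l : line K, line_in F l &
          [/\ on_line l PQR.1.1, on_line l PQR.1.2 & on_line l PQR.2]).

Definition G' : G -> Prop := gen_subgroup G'_gen.

Definition G'' : {pred G} := [pred D : G | `[< G' D >] && (deg D == 0)].

Fact G''_zmod_closed : zmod_closed G''.
Proof.
split=> [|x y]; rewrite !inE ?deg0 ?eqxx ?andbT.
  by apply/asboolP; exact: gen_subgroup0.
move=> /andP[/asboolP x'] /eqP dx /andP[/asboolP y'] /eqP dy.
rewrite degB dx dy subrr eqxx andbT.
by apply/asboolP; exact: gen_subgroupB.
Qed.
HB.instance Definition _ := GRing.isZmodClosed.Build G G'' G''_zmod_closed.

Definition H : zmodType := Quotient.quot G''.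

Definition degH : H -> int := lift_fun1 H (@deg (Spt F)).

Fact pi_degH : {mono \pi_H : D / deg D >-> degH D}.
Proof.
move=> D; unlock degH; apply/eqP; rewrite -subr_eq0 -degB.
have : repr (\pi_H D) - D \in G''.
  by rewrite Quotient.idealrBE reprK.
by rewrite inE => /andP[].
Qed.

Definition H0 : {pred H} := [pred x | degH x == 0].

End Groups.

Arguments G {K} F.
Arguments G'' {K} F _.
Arguments H {K} F.
Arguments H0 {K} F _.

(* Main.v *)
Require Import Defs.
From HB Require Import structures.
From mathcomp Require Import all_boot all_algebra.
From mathcomp Require Import mpoly freeg.
From mathcomp Require Import boolp ring.

Set Implicit Arguments.
Unset Strict Implicit.
Unset Printing Implicit Defensive.

Import GRing.Theory.

Local Open Scope ring_scope.

(** Write D_a(b) for the derivative at a, in the direction b, of the cubic form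
    F defining S. Restricted to the line through the points a and b of S, F is
      F(xa + yb) = xy (D_a(b) x + D_b(a) y),
    in every characteristic (cubic_on_line). Hence if the point ra + sb of the
    line satisfies D_a(b) r + D_b(a) s = 0, the sum of a, b and ra + sb is one
    of the generators of G'_S(K): either both derivatives vanish, and then the
    whole line lies in S, or the three points make up the intersection cycle of
    the line with S (residual_cycle).

    Any two generators have the same degree 3, so their difference vanishes in
    H_S(K). For a line l in S, comparing 3P with 2P + Q shows that all K-points
    of l have the same class (linked_on_line). Let A and B be the classes of the
    points of l1 and l2. The common value of all generators is then 3A.

    Fix a point a of l1. The linear form D_a has a nontrivial zero b on l2,
    since l2 is two-dimensional as a vector space (tangent_vector); this is the
    point where the tangent plane at a meets l2. The line ab touches S at a, so
    2a + b is a generator, and 2A + B = 3A gives A = B.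

    Finally let P be a point of S on neither line. As l1 and l2 are skew, K^4 is
    their direct sum, so P = u + w with u on l1 and w on l2. The equation
    F(u + w) = 0 reads D_u(w) + D_w(u) = 0, so u + w + P is a generator, and the
    class of P is 3A - A - B = A. Thus all points have the same class, and a divisor of
    degree 0 has class 0 (H0_trivial).

    Passing to {poly L} for an extension L of K is what gives multiplicities:
    the multiplicity at p of the line spanned by p and q is the order at t = 0
    of F(p + tq), so the expansion of F is stated with x and y in an arbitrary
    commutative algebra. *)

(** * Cubic forms along a line *)

Lemma rmorph_mmap (n : nat) (K : nzRingType) (R S : comNzRingType)
    (f : {rmorphism R -> S}) (g : {rmorphism K -> R}) (h : 'I_n -> R) p :
  f (mmap g h p) = mmap (f \o g) (f \o h) p.
Proof.
rewrite raddf_sum; apply: eq_bigr => m _ /=; rewrite rmorphM rmorph_prod.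
by congr (_ * _); apply: eq_bigr => i _; rewrite rmorphXn.
Qed.

Lemma eq_mmap (n : nat) (K R : nzRingType) (f f' : K -> R) (h h' : 'I_n -> R) p :
  f =1 f' -> h =1 h' -> mmap f h p = mmap f' h' p.
Proof.
move=> eqf eqh; apply: eq_bigr => m _; rewrite eqf; congr (_ * _).
exact: mmap1_eq.
Qed.

Lemma mdegS_split (n d : nat) (m : 'X_{1..n}) :
  mdeg m = d.+1 -> exists2 i, mdeg (m - U_(i))%MM = d & m = (U_(i) + (m - U_(i)))%MM.
Proof.
move=> dm; have [i mi] : exists i, m i != 0%N.
  apply/existsP; apply: contra_eqT dm => /existsPn m0.
  by rewrite mdegE big1 // => i _; apply/eqP; move: (m0 i); rewrite negbK.
have em : m = (U_(i) + (m - U_(i)))%MM.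
  by rewrite addmC submK // lep1mP.
by exists i => //; move: dm; rewrite {1}em mdegD mdeg1 => -[].
Qed.

(** A cubic form is a combination of monomials of degree 3, so an identity that
    is linear in the form need only be checked on products of three variables. *)
Lemma homog3_ind (n : nat) (K : nzRingType) (P : {mpoly K[n]} -> Prop) :
  P 0 -> (forall p q, P p -> P q -> P (p + q)) -> (forall c p, P p -> P (c *: p)) ->
  (forall i j k, P ('X_i * 'X_j * 'X_k)) ->
  forall p, p \is 3.-homog -> P p.
Proof.
move=> P0 PD PZ PX p /dhomogP hp; rewrite (mpolyE p) big_seq.
elim/big_ind: _ => // m /hp dm; apply: PZ.
have [i dm1 ->] := mdegS_split dm; have [j dm2 ->] := mdegS_split dm1.
have [k dm3 ->] := mdegS_split dm2.
move/eqP: dm3; rewrite mdeg_eq0 => /eqP ->.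
by rewrite addm0 !mpolyXD mulrA.
Qed.

(** At a smooth point a of the surface F = 0, the zeros of dirder F a form the
    tangent plane. *)
Definition dirder (n : nat) (K : nzRingType) (F : {mpoly K[n]}) (a b : 'rV[K]_n) :=
  \sum_i F^`M(i).@[a 0] * b 0 i.

Lemma dirder_lin (n : nat) (K : comNzRingType) (F : {mpoly K[n]}) a x b y c :
  dirder F a (x *: b + y *: c) = x * dirder F a b + y * dirder F a c.
Proof.
rewrite /dirder !mulr_sumr -big_split; apply: eq_bigr => i _ /=.
by rewrite !mxE; ring.
Qed.

Lemma dirder_XXX (n : nat) (K : comNzRingType) (i j k : 'I_n) (a b : 'rV[K]_n) :
  dirder ('X_i * 'X_j * 'X_k) a b =
  b 0 i * a 0 j * a 0 k + a 0 i * b 0 j * a 0 k + a 0 i * a 0 j * b 0 k.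
Proof.
have dX (l l' : 'I_n) : ('X_l : {mpoly K[n]})^`M(l') = (l == l')%:R%:MP.
  rewrite mderivX mnmE; case: eqP => [->|_]; last by rewrite scale0r mpolyC0.
  by rewrite -[X in (X - _)%MM]add0m addmK mpolyX0 scale1r mpolyC1.
have pick (l : 'I_n) (f : 'I_n -> K) :
    \sum_i (l == i)%:R * f i = f l.
  rewrite (bigD1 l) //= eqxx mul1r big1 ?addr0 // => l' /negPf.
  by rewrite eq_sym => ->; rewrite mul0r.
rewrite -(pick i (fun l => b 0 l * a 0 j * a 0 k)).
rewrite -(pick j (fun l => a 0 i * b 0 l * a 0 k)).
rewrite -(pick k (fun l => a 0 i * a 0 j * b 0 l)).
rewrite -!big_split; apply: eq_bigr => l _ /=.
rewrite !mderivM !dX !(mevalD, mevalM, mevalC, mevalXU); ring.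
Qed.

(** The Taylor expansion of a cubic form stops at order 3, and by the symmetry
    between a and b its two middle coefficients are first derivatives, so no
    second derivative, and no factor 1/2, appears. *)
Lemma cubic_on_line (n : nat) (K R : comNzRingType) (f : {rmorphism K -> R})
    (F : {mpoly K[n]}) (a b : 'rV[K]_n) (x y : R) :
  F \is 3.-homog ->
  mmap f (fun i => f (a 0 i) * x + f (b 0 i) * y) F =
  f F.@[a 0] * x ^+ 3 + f (dirder F a b) * x ^+ 2 * y
  + f (dirder F b a) * x * y ^+ 2 + f F.@[b 0] * y ^+ 3.
Proof.
have der0 u v : dirder (0 : {mpoly K[n]}) u v = 0.
  by rewrite /dirder big1 // => i _; rewrite mderiv0 meval0 mul0r.
have derD p q u v : dirder (p + q) u v = dirder p u v + dirder q u v.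
  by rewrite /dirder -big_split; apply: eq_bigr => i _; rewrite mderivD mevalD mulrDl.
have derZ c p u v : dirder (c *: p) u v = c * dirder p u v.
  by rewrite /dirder mulr_sumr; apply: eq_bigr => i _; rewrite mderivZ mevalZ mulrA.
move: F; apply: homog3_ind => [|p q|c p|i j k].
- by rewrite mmap0 !meval0 !der0 rmorph0; ring.
- by rewrite mmapD !mevalD !derD !rmorphD => -> ->; ring.
- by rewrite mmapZ !mevalZ !derZ !rmorphM => ->; ring.
rewrite !rmorphM /= !mmapX !mmap1U !mevalXU !dirder_XXX !rmorphD !rmorphM /=.
ring.
Qed.

(** * Planes in coordinates and base change *)

Lemma span2P (K : fieldType) (V : vectType K) (a b v : V) :
  reflect (exists x y, v = x *: a + y *: b) (v \in <<[:: a; b]>>)%VS.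
Proof.
rewrite span_cons span_seq1; apply: (iffP memv_addP).
  by move=> [_ /vlineP[x ->]] [_ /vlineP[y ->] ->]; exists x, y.
move=> [x [y ->]]; exists (x *: a); first by apply/vlineP; exists x.
by exists (y *: b) => //; apply/vlineP; exists y.
Qed.

Lemma free2P (K : fieldType) (V : vectType K) (a b : V) :
  reflect (forall x y, x *: a + y *: b = 0 -> x = 0 /\ y = 0) (free [:: a; b]).
Proof.
rewrite free_cons span_seq1 seq1_free; apply: (iffP andP) => [[a'b b0] x y xy0|ab].
  have x0 : x = 0.
    apply: contraNeq a'b => x0; apply/vlineP; exists (- x^-1 * y).
    apply: (scalerI x0); rewrite scalerA mulrA mulrN divff // mulN1r scaleNr.
    by apply/eqP; rewrite -addr_eq0 xy0.
  move/eqP: xy0; rewrite x0 scale0r add0r scaler_eq0 (negPf b0) orbF.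
  by move/eqP.
split; last first.
  apply/negP => /eqP b0; have [|_ /eqP] := ab 0 1; rewrite ?oner_eq0 //.
  by rewrite b0 scale0r scaler0 addr0.
apply/negP => /vlineP[k ak]; have [|/eqP] := ab 1 (- k); rewrite ?oner_eq0 //.
by rewrite ak scale1r scaleNr subrr.
Qed.

(** The rank of a matrix is insensitive to field extension. *)
Lemma free_map2 (K L : fieldType) (f : {rmorphism K -> L}) n (a b : 'rV[K]_n) :
  free [:: a; b] -> free [:: map_mx f a; map_mx f b].
Proof.
move=> /free2P ab; apply/free2P => x y xy0.
have : row_free (map_mx f (col_mx a b)).
  rewrite row_free_map; apply: inj_row_free => v.
  rewrite -[v]hsubmxK mul_row_col [lsubmx v]mx11_scalar [rsubmx v]mx11_scalar.
  by rewrite !mul_scalar_mx => /ab[-> ->]; rewrite !raddf0 row_mx0.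
rewrite map_col_mx => /row_free_inj inj.
have /inj : row_mx (x%:M : 'M_1) (y%:M : 'M_1) *m col_mx (map_mx f a) (map_mx f b)
    = 0 *m col_mx (map_mx f a) (map_mx f b).
  by rewrite mul_row_col !mul_scalar_mx xy0 mul0mx.
rewrite -row_mx0 => /eq_row_mx[x0 y0].
by split; [move/matrixP: x0 | move/matrixP: y0] => /(_ 0 0); rewrite !mxE.
Qed.

Lemma map_mem_span (K L : fieldType) (f : {rmorphism K -> L}) n
    (s : seq 'rV[K]_n) v :
  v \in <<s>>%VS -> map_mx f v \in <<[seq map_mx f u | u <- s]>>%VS.
Proof.
elim: s v => [|u s IHs] v /=.
  by rewrite !span_nil !memv0 => /eqP ->; rewrite map_mx0.
rewrite !span_cons => /memv_addP[_ /vlineP[k ->]] [w sw ->].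
by rewrite map_mxD map_mxZ memv_add ?IHs //; apply/vlineP; exists (f k).
Qed.

(** The base change is defined through a chosen basis; any spanning family gives
    the same space. *)
Lemma baseChange_span (K L : fieldType) (f : {rmorphism K -> L}) s :
  baseChange f <<s>> = <<[seq map_mx f v | v <- s]>>%VS.
Proof.
apply/eqP; rewrite eqEsubv; apply/andP.
split; apply/span_subvP => _ /mapP[v vs ->]; apply: map_mem_span.
  exact: vbasis_mem.
by rewrite (span_basis (vbasisP _)) memv_span.
Qed.

Lemma line_span (K : fieldType) (l : line K) :
  [/\ free [:: (vbasis (val l))`_0; (vbasis (val l))`_1]
    & val l = <<[:: (vbasis (val l))`_0; (vbasis (val l))`_1]>>%VS].
Proof.
have := basis_free (vbasisP (val l)); have := span_basis (vbasisP (val l)).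
move: (vbasis _) (eqP (valP l)) => s d2; have : size s = 2 by rewrite size_tuple.
by case: (tval s) => [|a [|b []]].
Qed.

(** * Lines in the surface *)

(** Containment of a line is an identity of polynomials, so it can be
    specialized in every commutative K-algebra, for any two vectors of the line. *)
Lemma line_in_vanish (K : fieldType) (F : {mpoly K[4]}) (l : line K) a b :
  line_in F l -> a \in val l -> b \in val l ->
  forall (R : comNzRingType) (f : {rmorphism K -> R}) (x y : R),
    mmap f (fun i => f (a 0 i) * x + f (b 0 i) * y) F = 0.
Proof.
move=> lF la lb R f x y; have [_ lE] := line_span l.
move: la lb; rewrite lE => /span2P[a0 [a1 ->]] /span2P[b0 [b1 ->]].
pose h (k : 'I_2) := if k == 0 then f a0 * x + f b0 * y else f a1 * x + f b1 * y.
rewrite -[RHS](rmorph0 (mmap f h)) -lF [in RHS]/restr rmorph_mmap.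
apply: eq_mmap => [c|i] /=; first by rewrite mmapC.
rewrite tnth_mktuple big_ord_recl big_ord1 !mmapD !mmapZ !mmapX !mmap1U /h /=.
rewrite !mxE !rmorphD !rmorphM /=; ring.
Qed.

Lemma line_in_vanish_at (K : fieldType) (F : {mpoly K[4]}) (l : line K) v :
  line_in F l -> v \in val l -> F.@[v 0] = 0.
Proof.
move=> lF lv; rewrite -[RHS](line_in_vanish lF lv lv idfun 1 0).
by apply: eq_mmap => // i; rewrite mulr1 mulr0 addr0.
Qed.

(** Containment is tested on the two coefficients of xy(D_a(b) x + D_b(a) y):
    this remains valid over small fields, where it could not be read off from the
    K-points of the line. *)
Lemma line_in_dirder (K : fieldType) (F : {mpoly K[4]}) (l : line K) a b :
  F \is 3.-homog -> val l = <<[:: a; b]>>%VS -> F.@[a 0] = 0 -> F.@[b 0] = 0 ->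
  line_in F l <-> dirder F a b = 0 /\ dirder F b a = 0.
Proof.
move=> F3 lE Fa Fb; split=> [lF | [ab0 ba0]].
  have al : a \in val l by rewrite lE memv_span ?mem_head.
  have bl : b \in val l by rewrite lE memv_span ?inE ?eqxx ?orbT.
  (* Dehomogenized along a + tb, the two derivatives are the coefficients of t and
     of t^2. *)
  have := line_in_vanish lF al bl polyC 1 'X; rewrite cubic_on_line // Fa Fb.
  move/polyP => E; have := E 1%N; have := E 2%N.
  rewrite !(polyC0, mul0r, addr0, add0r, expr1n, mulr1).
  rewrite !(coefD, coefCM, coefXn, coefX, coef0) /=.
  by rewrite !(mulr1, mulr0, addr0, add0r) => -> ->.
have [_ lE'] := line_span l.
have vl k : (k < 2)%N -> exists x y, (vbasis (val l))`_k = x *: a + y *: b.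
  move=> k2; apply/span2P; rewrite -lE; apply: vbasis_mem; apply: mem_nth.
  by rewrite size_tuple (eqP (valP l)).
have [x0 [y0 e0]] := vl 0 isT; have [x1 [y1 e1]] := vl 1 isT.
have := cubic_on_line (@mpolyC 2 K) a b (x0 *: 'X_0 + x1 *: 'X_1)
  (y0 *: 'X_0 + y1 *: 'X_1) F3.
rewrite Fa Fb ab0 ba0 !rmorph0 !mul0r !addr0 => E.
rewrite /line_in -[RHS]E.
apply: eq_mmap => // i; rewrite tnth_mktuple big_ord_recl big_ord1 e0 e1 !mxE.
rewrite -!mul_mpolyC !mpolyCD !mpolyCM /=; ring.
Qed.

(** * Intersection cycles *)

Lemma linear_neq0 (L : nzRingType) (u v : L) :
  (u != 0) || (v != 0) -> u%:P + v *: 'X != 0.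
Proof.
apply: contraTneq => /polyP e; have := e 0%N; have := e 1%N.
rewrite !(coefD, coefC, coefZ, coefX) /= !(mulr1, mulr0, addr0, add0r) => -> ->.
by rewrite eqxx.
Qed.

Lemma mup0_linear (L : fieldType) (u v : L) :
  (u != 0) || (v != 0) -> mup 0 (u%:P + v *: 'X) = (u == 0).
Proof.
have [->|u0] /= := eqVneq u 0; last first.
  move=> _; apply: mupNroot.
  by rewrite /root !(hornerD, hornerC, hornerZ, hornerX) mulr0 addr0.
move=> v0; rewrite add0r -mul_polyC mupMr; last by rewrite /root hornerC.
by rewrite -['X]subr0 -polyC0 -[_ - _]expr1 mup_XsubCX eqxx.
Qed.

(** Up to a scalar, a nonzero vector is the only zero of the linear form that
    takes the determinant with it. *)
Lemma det2_eq0 (L : fieldType) (a b x y : L) :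
  (a != 0) || (b != 0) -> b * x - a * y = 0 -> exists k, x = k * a /\ y = k * b.
Proof.
have [->|a0] /= := eqVneq a 0.
  move=> b0; rewrite mul0r subr0 => /eqP; rewrite mulf_eq0 (negPf b0) /= => /eqP ->.
  by exists (y / b); rewrite mulr0 divfK.
move=> _ /eqP; rewrite subr_eq0 => /eqP e; exists (x / a); rewrite divfK //; split=> //.
by apply: (mulfI a0); rewrite -e; field.
Qed.

Lemma eq_vline (K : fieldType) (V : vectType K) (u v : V) k :
  v != 0 -> v = k *: u -> (<[u]> == <[v]>)%VS.
Proof.
move=> v0 e; rewrite eq_sym eqEdim !dim_vline v0 leq_b1 andbT.
by apply/subvP => _ /vlineP[c ->]; rewrite e scalerA; apply/vlineP; exists (c * k).
Qed.

Lemma dim1_vline (K : fieldType) (V : vectType K) (U : {vspace V}) :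
  \dim U = 1%N -> vpick U != 0 /\ U = <[vpick U]>%VS.
Proof.
move=> dU; have p0 : vpick U != 0 by rewrite vpick0 -dimv_eq0 dU.
split=> //; apply/eqP; rewrite eq_sym eqEdim dim_vline p0 dU andbT.
by apply/subvP => _ /vlineP[c ->]; rewrite memvZ ?memv_pick.
Qed.

(** If F splits on a plane into linear forms, each vanishing at one of the points
    of a list, then each form contributes to the multiplicity at X exactly when
    its point is X: along p + tq it restricts to a linear polynomial in t, nonzero
    because q is not in X, whose constant term is its value at p. *)
Lemma inter_mult_split (L : fieldType) (F : {mpoly L[4]}) (a b : 'rV[L]_4)
    (X : pt L) (c : L) (s : seq (L * L)) :
  free [:: a; b] -> (val X <= <<[:: a; b]>>)%VS -> c != 0 ->
  all (fun w => (w.1 != 0) || (w.2 != 0)) s ->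
  (forall x y : {poly L},
     mmap polyC (fun i => (a 0 i)%:P * x + (b 0 i)%:P * y) F =
     c%:P * \prod_(w <- s) (w.2%:P * x - w.1%:P * y)) ->
  inter_mult F <<[:: a; b]>>%VS (val X) =
    count_mem (val X) [seq <[w.1 *: a + w.2 *: b]>%VS | w <- s].
Proof.
move=> ab subX c0 s0 FE; rewrite /inter_mult.
have [p0 XE] := dim1_vline (eqP (valP X)); set p := vpick _ in p0 XE *.
set q := vpick _.
have abV : \dim <<[:: a; b]>> = 2 by apply/eqP; exact: ab.
have q0 : q != 0.
  rewrite vpick0 diffv_eq0; apply/negP => /dimvS.
  by rewrite abV (eqP (valP X)).
have qX : q \notin val X.
  apply: contra q0 => qX; rewrite -memv0 -(capv_diff <<[:: a; b]>> (val X)).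
  by rewrite memv_cap memv_pick.
have qV : q \in <<[:: a; b]>>%VS.
  by apply: (subvP (diffvSl _ (val X))); exact: memv_pick.
have pV : p \in <<[:: a; b]>>%VS by apply: (subvP subX); exact: memv_pick.
case/span2P: pV => x1 [y1 pE]; case/span2P: qV => x2 [y2 qE].
have factor (w : L * L) : (w.1 != 0) || (w.2 != 0) ->
    ((w.2 * x1 - w.1 * y1 != 0) || (w.2 * x2 - w.1 * y2 != 0)) &&
    ((w.2 * x1 - w.1 * y1 == 0) == (<[w.1 *: a + w.2 *: b]>%VS == val X)).
  case: w => u v /= uv.
  (* The form attached to (u, v) vanishes at p exactly when (u, v) spans p. *)
  have pk k : x1 = k * u /\ y1 = k * v -> p = k *: (u *: a + v *: b).
    by case=> ex ey; rewrite pE ex ey scalerDr !scalerA.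
  apply/andP; split.
    (* If the form vanished at q as well, q would be a multiple of p. *)
    rewrite -negb_and; apply: contra qX => /andP[/eqP/(det2_eq0 uv)[k /pk pk']].
    move=> /eqP/(det2_eq0 uv)[k' [ex ey]].
    have k0 : k != 0 by apply: contraNneq p0 => k0; rewrite pk' k0 scale0r.
    rewrite XE; apply/vlineP; exists (k' / k).
    by rewrite pk' scalerA divfK // qE ex ey scalerDr !scalerA.
  apply/eqP; apply/idP/idP => [/eqP/(det2_eq0 uv)[k /pk]|/eqP e].
    by rewrite XE; exact: eq_vline.
  have: p \in <[u *: a + v *: b]>%VS by rewrite e; exact: memv_pick.
  case/vlineP=> k pk'; have [|] := (elimT (free2P _ _) ab) (x1 - k * u) (y1 - k * v).
    rewrite !scalerBl addrACA -opprD -pE pk' scalerDr !scalerA; exact: subrr.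
  move=> /eqP; rewrite subr_eq0 => /eqP -> /eqP; rewrite subr_eq0 => /eqP ->.
  by apply/eqP; ring.
have -> : mmap polyC (fun i => (p 0 i)%:P + q 0 i *: 'X) F =
    c%:P * \prod_(w <- s) ((w.2 * x1 - w.1 * y1)%:P + (w.2 * x2 - w.1 * y2) *: 'X).
  rewrite [RHS](_ : _ = c%:P * \prod_(w <- s)
      (w.2%:P * (x1%:P + x2 *: 'X) - w.1%:P * (y1%:P + y2 *: 'X))); last first.
    congr (_ * _); apply: eq_bigr => w _; rewrite -!mul_polyC; ring.
  rewrite -FE; apply: eq_mmap => // i.
  by rewrite pE qE !mxE -!mul_polyC; ring.
rewrite mupMr; last by rewrite /root hornerC.
elim: s s0 {FE} => [|w s IHs] /=.
  by move=> _; rewrite big_nil; apply: mupNroot; rewrite root1.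
case/andP=> /factor/andP[w0 /eqP <-] s0; rewrite big_cons mupM.
- by rewrite IHs // mup0_linear.
- exact: linear_neq0.
rewrite prodf_seq_neq0; apply/allP => w' /(allP s0)/factor/andP[w0' _] /=.
exact: linear_neq0.
Qed.

Lemma factor_residual (K : fieldType) (u v a b : K) :
  (a != 0) || (b != 0) -> u * a + v * b = 0 ->
  exists c, u = c * b /\ v = - (c * a).
Proof.
move=> ab uv; have [||k [-> ev]] := @det2_eq0 _ b (- a) u v.
- by rewrite oppr_eq0 orbC.
- by rewrite -[RHS]oppr0 -uv; ring.
by exists k; rewrite ev mulrN.
Qed.

(** The third point of a line through two points of S is read off from the linear
    factor of F on that line. Both kinds of generators occur here: the factor may
    vanish identically, and then the line lies in S. *)
Lemma residual_cycle (K : fieldType) (F : {mpoly K[4]}) (PA PB PR : Spt F)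
    (A B : 'rV[K]_4) (a b : K) :
  F \is 3.-homog -> free [:: A; B] -> (a != 0) || (b != 0) ->
  val (val PA) = <[A]>%VS -> val (val PB) = <[B]>%VS ->
  val (val PR) = <[a *: A + b *: B]>%VS ->
  F.@[A 0] = 0 -> F.@[B 0] = 0 -> dirder F A B * a + dirder F B A * b = 0 ->
  G'_gen (<<PA>> + <<PB>> + <<PR>>).
Proof.
move=> F3 AB ab eA eB eR FA FB dAB; exists (PA, PB, PR) => //=.
have dimAB : \dim <<[:: A; B]>> == 2 by exact: AB.
pose l : line K := exist _ <<[:: A; B]>>%VS dimAB.
have lP := line_in_dirder (l := l) F3 erefl FA FB.
have [c [cA cB]] := factor_residual ab dAB.
have [c0|c0] := eqVneq c 0.
  right; exists l; first by apply/lP; rewrite cA cB c0 !mul0r oppr0.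
  split; rewrite /on_line ?eA ?eB ?eR -memvE; apply/span2P.
  - by exists 1, 0; rewrite scale1r scale0r addr0.
  - by exists 0, 1; rewrite scale1r scale0r add0r.
  by exists a, b.
left; exists l.
  move/lP; rewrite cA cB => -[/eqP + /eqP]; rewrite oppr_eq0 !mulf_eq0 (negPf c0) /=.
  by move: ab => /orP[] /negPf ->.
move=> L f X; rewrite !map_cons eA eB eR -!span_seq1 !baseChange_span.
rewrite !map_cons map_mxD !map_mxZ !span_seq1.
set A' := map_mx f A; set B' := map_mx f B => XV.
(* The forms attached to A, B and aA + bB are -y, x and bx - ay; their product
   has the sign opposite to F, whence the constant - c. *)
pose s : seq (L * L) := [:: (1, 0); (0, 1); (f a, f b)].
rewrite (@inter_mult_split _ _ A' B' X (- f c) s) //.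
- by rewrite !map_cons !scale1r !scale0r addr0 add0r.
- exact: free_map2.
- by rewrite oppr_eq0 fmorph_eq0.
- by rewrite /= !oner_eq0 orbT !fmorph_eq0 ab.
move=> x y; rewrite rmorph_mmap.
rewrite -[LHS](_ : mmap (polyC \o f)
  (fun i => (polyC \o f) (A 0 i) * x + (polyC \o f) (B 0 i) * y) F = _); last first.
  apply: eq_mmap => [k|i] /=; first by rewrite mmapC.
  by rewrite mmapX mmap1U !mxE.
rewrite cubic_on_line // FA FB cA cB /s !big_cons big_nil /=.
rewrite !(rmorph0, rmorph1, rmorphN, rmorphM) /=; ring.
Qed.

Lemma spt_rep (K : fieldType) (F : {mpoly K[4]}) (P : Spt F) :
  exists v : 'rV[K]_4, [/\ v != 0, F.@[v 0] = 0 & val (val P) = <[v]>%VS].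
Proof.
have [v0 PE] := dim1_vline (eqP (valP (val P))).
by exists (vpick (val (val P))); split=> //; apply/eqP; exact: (valP P).
Qed.

(** Whether a point is on the surface is tested at a chosen representative, so
    homogeneity is needed to pass to another one. *)
Lemma spt_of_vec (K : fieldType) (F : {mpoly K[4]}) (v : 'rV[K]_4) :
  F \is 3.-homog -> v != 0 -> F.@[v 0] = 0 ->
  exists P : Spt F, val (val P) = <[v]>%VS.
Proof.
move=> F3 v0 Fv; have dv : \dim <[v]> == 1 by rewrite dim_vline v0.
have /vlineP[k vE] := memv_pick <[v]>.
pose p : pt K := exist _ <[v]>%VS dv.
suff SP : on_surface F p by exists (exist (fun P => on_surface F P) p SP).
rewrite /on_surface /= vE; apply/eqP.
have := cubic_on_line idfun v 0 k 0 F3; rewrite /= Fv => E.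
rewrite -[RHS](_ : 0 * k ^+ 3 + dirder F v 0 * k ^+ 2 * 0 + dirder F 0 v * k * 0 ^+ 2
   + F.@[(0 : 'rV[K]_4) 0] * 0 ^+ 3 = 0); last by ring.
rewrite -E; apply: eq_mmap => // i; rewrite !mxE; ring.
Qed.

(** * The class group *)

Definition linked (K : fieldType) (F : {mpoly K[4]}) (P Q : Spt F) :=
  (<<P>> - <<Q>> : G F) \in G'' F.

Lemma linked_trans (K : fieldType) (F : {mpoly K[4]}) (P Q R : Spt F) :
  linked P Q -> linked Q R -> linked P R.
Proof.
by move=> PQ QR; rewrite /linked -[<<P>>](subrK <<Q>>) -addrA; apply: rpredD.
Qed.

Lemma G'_gen_sub (K : fieldType) (F : {mpoly K[4]}) (D E : G F) :
  G'_gen D -> G'_gen E -> D - E \in G'' F.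
Proof.
move=> hD hE; rewrite inE; apply/andP; split.
  by apply/asboolP; apply: gen_subgroupB; apply: gen_subgroup_in.
by case: hD => -[[P Q] R] -> _; case: hE => -[[P' Q'] R'] -> _;
   rewrite degB !degD !degU.
Qed.

(** P - Q is the difference of the generators 3P and 2P + Q. *)
Lemma linked_on_line (K : fieldType) (F : {mpoly K[4]}) (l : line K) (P Q : Spt F) :
  line_in F l -> on_line l P -> on_line l Q -> linked P Q.
Proof.
move=> lF lP lQ; rewrite /linked.
rewrite (_ : _ - _ = <<P>> + <<P>> + <<P>> - (<<P>> + <<P>> + <<Q>>) :> G F); last first.
  by rewrite opprD addrACA subrr add0r.
by apply: G'_gen_sub; [exists (P, P, P) | exists (P, P, Q)] => //; right; exists l.
Qed.

(** Modulo the differences P - P0, a divisor D equals deg(D) P0. *)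
Lemma H0_trivial (K : fieldType) (F : {mpoly K[4]}) (P0 : Spt F) :
  (forall P, linked P P0) -> H0 F =i pred1 0.
Proof.
move=> link x.
have pi0 : \pi_(H F)%qT (0 : G F) = 0 by exact: pi_zeror.
rewrite !inE; apply/eqP/eqP => [dx|->]; last by rewrite -pi0 pi_degH deg0.
have [D xE] : exists D : G F, x = \pi_(H F)%qT D by exists (repr x); rewrite reprK.
rewrite xE pi_degH in dx; rewrite xE.
suff DG : D \in G'' F by apply/eqP; rewrite -pi0 -Quotient.idealrBE subr0.
have concentrate E : E - <<deg E *g P0>> \in G'' F.
  rewrite -[E]freeg_sumE; elim: (dom E) => [|P s IHs].
    by rewrite big_nil deg0 freegU0 subrr rpred0.
  rewrite big_cons degD degU -freegUD opprD addrACA; apply: rpredD => //.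
  have zU (k : int) Q : << k *g Q >> = << Q >> *~ k :> G F.
    by rewrite freegU_mulz intz.
  by rewrite (zU _ P) (zU _ P0) -mulrzBl rpredMz //; exact: link.
by have := concentrate D; rewrite dx freegU0 subr0.
Qed.

(** A linear form on a two-dimensional space has a nontrivial zero. *)
Lemma tangent_vector (K : fieldType) (n : nat) (F : {mpoly K[n]}) (a b c : 'rV[K]_n) :
  free [:: b; c] ->
  exists v, [/\ v != 0, v \in <<[:: b; c]>>%VS & dirder F a v = 0].
Proof.
move=> bc; have [b0|b0] := eqVneq (dirder F a b) 0.
  exists b; split=> //; last by rewrite memv_span ?mem_head.
  by apply: contraTneq bc => ->; rewrite free_cons mem0v.
exists (dirder F a c *: b + (- dirder F a b) *: c); split.
- apply: contra_neqN b0 => /eqP/(elimT (free2P _ _) bc)[_ /eqP].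
  by rewrite oppr_eq0 => /eqP.
- by apply/span2P; eexists; eexists.
by rewrite dirder_lin; ring.
Qed.

Lemma skew_free (K : fieldType) (V : vectType K) (U W : {vspace V}) a b :
  (U :&: W = 0)%VS -> a \in U -> b \in W -> a != 0 -> b != 0 -> free [:: a; b].
Proof.
move=> UW Ua Wb a0 b0; apply/free2P => x y /eqP; rewrite addr_eq0 => /eqP xy.
have : x *: a \in (U :&: W)%VS by rewrite memv_cap memvZ // xy memvN memvZ.
rewrite UW memv0 scaler_eq0 (negPf a0) orbF => /eqP x0; split=> //.
move/esym/eqP: xy; rewrite x0 scale0r oppr_eq0 scaler_eq0 (negPf b0) orbF.
by move/eqP.
Qed.

Lemma skew_lines_span (K : fieldType) (l1 l2 : line K) v :
  (val l1 :&: val l2 = 0)%VS -> v \in (val l1 + val l2)%VS.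
Proof.
move=> skew; suff -> : (val l1 + val l2 = fullv)%VS by exact: memvf.
apply/eqP; rewrite eqEdim subvf dimvf dim_matrix /=.
by have := dimv_sum_cap (val l1) (val l2);
  rewrite skew dimv0 addn0 (eqP (valP l1)) (eqP (valP l2)) => ->.
Qed.

Theorem theorem7 (K : fieldType) (F : {mpoly K[4]})
    (F_cubic : F \is 3.-homog) (F_smooth : smooth F)
    (l1 l2 : line K) (l1_in_S : line_in F l1) (l2_in_S : line_in F l2)
    (l1_l2_skew : (val l1 :&: val l2 = 0)%VS) :
  H0 F =i pred1 0.
Proof.
have point (l : line K) v : line_in F l -> v \in val l -> v != 0 ->
    exists P : Spt F, val (val P) = <[v]>%VS /\ on_line l P.
  move=> lF lv v0; have [P PE] := spt_of_vec F_cubic v0 (line_in_vanish_at lF lv).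
  by exists P; rewrite /on_line PE -memvE.
have [free_1 _] := line_span l1; have [free_2 l2E] := line_span l2.
set a := _`_0 in free_1; have a0 : a != 0.
  by apply: contraTneq free_1 => ->; rewrite free_cons mem0v.
have l1a : a \in val l1.
  by apply: vbasis_mem; rewrite mem_nth // size_tuple (eqP (valP l1)).
have [b [b0 l2b dab]] := tangent_vector F a free_2.
rewrite -l2E in l2b.
have [Pa [Pa_eq Pa_l1]] := point _ _ l1_in_S l1a a0.
have [Pb [Pb_eq Pb_l2]] := point _ _ l2_in_S l2b b0.
have ab_free := skew_free l1_l2_skew l1a l2b a0 b0.
(* D_a(b) = 0 makes a itself the residual point of the line ab. *)
have aab : G'_gen (<<Pa>> + <<Pb>> + <<Pa>> : G F).
  apply: (@residual_cycle _ _ _ _ _ a b 1 0) => //.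
  - by rewrite oner_eq0.
  - by rewrite scale1r scale0r addr0.
  - exact: (line_in_vanish_at l1_in_S).
  - exact: (line_in_vanish_at l2_in_S).
  by rewrite dab mul0r mulr0 addr0.
have aaa : G'_gen (<<Pa>> + <<Pa>> + <<Pa>> : G F).
  by exists (Pa, Pa, Pa) => //; right; exists l1.
have ba : linked Pb Pa.
  rewrite /linked (_ : _ - _ = (<<Pa>> + <<Pb>> + <<Pa>>)
    - (<<Pa>> + <<Pa>> + <<Pa>>) :> G F).
    exact: G'_gen_sub.
  by rewrite !opprD addrACA subrr addr0 addrACA subrr add0r.
have on_l1 P : on_line l1 P -> linked P Pa.
  by move=> l1P; apply: linked_on_line l1_in_S l1P Pa_l1.
have on_l2 P : on_line l2 P -> linked P Pa.
  by move=> l2P; apply: linked_trans ba; apply: linked_on_line l2_in_S l2P Pb_l2.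
apply: (H0_trivial (P0 := Pa)) => P; have [v [v0 Fv PE]] := spt_rep P.
have /memv_addP[u l1u [w l2w vE]] := skew_lines_span v l1_l2_skew.
have [u0|u0] := eqVneq u 0.
  by apply: on_l2; rewrite /on_line PE -memvE vE u0 add0r.
have [w0|w0] := eqVneq w 0.
  by apply: on_l1; rewrite /on_line PE -memvE vE w0 addr0.
have [Pu [Pu_eq Pu_l1]] := point _ _ l1_in_S l1u u0.
have [Pw [Pw_eq Pw_l2]] := point _ _ l2_in_S l2w w0.
have Fu := line_in_vanish_at l1_in_S l1u; have Fw := line_in_vanish_at l2_in_S l2w.
have uwP : G'_gen (<<Pu>> + <<Pw>> + <<P>> : G F).
  apply: (@residual_cycle _ _ _ _ _ u w 1 1) => //.
  - exact: skew_free l1_l2_skew l1u l2w u0 w0.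
  - by rewrite oner_eq0.
  - by rewrite !scale1r -vE.
  (* D_u(w) + D_w(u) = F(u + w), because F vanishes at u and at w. *)
  have := cubic_on_line idfun u w 1 1 F_cubic.
  rewrite /= Fu Fw !expr1n !mulr1 add0r addr0 => <-.
  rewrite -Fv vE; apply: eq_mmap => // i.
  by rewrite !mulr1 !mxE.
rewrite /linked (_ : _ - _ = (<<Pu>> + <<Pw>> + <<P>> - (<<Pa>> + <<Pa>> + <<Pa>>))
  - (<<Pu>> - <<Pa>>) - (<<Pw>> - <<Pa>>) :> G F).
  apply: rpredB (on_l2 _ Pw_l2); apply: rpredB (on_l1 _ Pu_l1).
  exact: G'_gen_sub.
rewrite [- (_ + _ + <<Pa>>)]opprD [- (_ + <<Pa>>)]opprD.
rewrite [_ + _ + <<P>> + _]addrACA [_ + <<Pw>> + _]addrACA.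
by rewrite -[RHS]addrA -opprD [RHS]addrC addKr.
Qed.
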